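(* For a partition $\lambda$ let $\widetilde{\mathrm{wt}}_{\mathbb{Z}_3}(\lambda)=\left|\{\square\in\lambda : a(\square)+1\equiv l(\square) \pmod 3\}\right|$. Define partial maps $\rho_1,\psi_2$ on partitions as follows, where $j=\lambda_1$ is the length of the first (bottom) row and $k=\lambda'_1$ the height of the first (leftmost) column of $\lambda$: - $\rho_1(\lambda)$ is defined iff $j\ge k-2$, and is the partition with column heights $j+1,\lambda'_1-1,\lambda'_2-1,\dots,\lambda'_j-1$ (zeros discarded), i.e. remove the first row, add one box, and insert it as a new first column; - $\psi_2(\lambda)$ is defined iff $j\le k+3$, and is the partition with row lengths $k+2,\lambda_1-1,\dots,\lambda_k-1$ (zeros discarded), i.e. remove the first column, add two boxes, and insert it as a new first row. Then if $\rho_1(\lambda)$ is defined, $\widetilde{\mathrm{wt}}_{\mathbb{Z}_3}(\rho_1(\lambda))=\widetilde{\mathrm{wt}}_{\mathbb{Z}_3}(\lambda)$, and if $\psi_2(\lambda)$ is defined, $\widetilde{\mathrm{wt}}_{\mathbb{Z}_3}(\psi_2(\lambda))=\widetilde{\mathrm{wt}}_{\mathbb{Z}_3}(\lambda)+1$.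
   Context: Partitions are drawn as southwest-justified Young diagrams: $\lambda_r$ is the number of boxes in the $r$-th row from the bottom, $\lambda'_c$ the height of the $c$-th column from the left. For a box $\square\in\lambda$, the arm $a(\square)$ is the number of boxes strictly above $\square$ in its column and the leg $l(\square)$ the number of boxes strictly to the right of $\square$ in its row. *)

(* Defs.v *)
From HB Require Import structures.
From mathcomp Require Import all_boot.

Set Implicit Arguments.
Unset Strict Implicit.
Unset Printing Implicit Defensive.

(* A partition is the weakly decreasing sequence of its positive row lengths,
   listed from the bottom row up. *)
Definition is_intpart (s : seq nat) : bool := sorted geq s && (0 \notin s).

Record intpart := IntPart { parts :> seq nat; partsP : is_intpart parts }.

HB.instance Definition _ := [isSub for parts].
HB.instance Definition _ := [Countable of intpart by <:].

(* Rows and columns are numbered from 0: the paper's lambda_r is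
   [row_len lam r.-1] and its lambda'_c is [col_len lam c.-1]. *)
Definition row_len (lam : seq nat) (r : nat) : nat := nth 0 lam r.
Definition col_len (lam : seq nat) (c : nat) : nat := count (fun x => c < x) lam.
Definition cols (lam : seq nat) : seq nat := mkseq (col_len lam) (row_len lam 0).

(* A box is a pair (row, column). *)
Definition boxes (lam : seq nat) : seq (nat * nat) :=
  [seq (r, c) | r <- iota 0 (size lam), c <- iota 0 (row_len lam r)].

Definition arm (lam : seq nat) (b : nat * nat) : nat :=
  count (fun b' => (b'.2 == b.2) && (b.1 < b'.1)) (boxes lam).
Definition leg (lam : seq nat) (b : nat * nat) : nat :=
  count (fun b' => (b'.1 == b.1) && (b.2 < b'.2)) (boxes lam).

Definition wt3 (lam : seq nat) : nat :=
  count (fun b => arm lam b + 1 == leg lam b %[mod 3]) (boxes lam).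

Lemma sorted_geq_subn1 s : sorted geq s -> sorted geq [seq x - 1 | x <- s].
Proof. by apply: homo_sorted => x y; rewrite /geq /=; apply: leq_sub2r. Qed.

Lemma is_intpart_nz s : sorted geq s -> is_intpart [seq x <- s | x != 0].
Proof.
move=> ss; rewrite /is_intpart mem_filter andbT.
by apply: sorted_filter ss => y x z xy zx; apply: leq_trans zx xy.
Qed.

Lemma is_intpart_cols lam : is_intpart (cols lam).
Proof.
apply/andP; split.
  rewrite /cols /mkseq; apply: (homo_sorted (e := leq)); last exact: iota_sorted.
  by move=> c d cd; apply: sub_count => x /=; apply: leq_ltn_trans.
apply/mapP => -[c]; rewrite mem_iota add0n /= => c_lt /esym /eqP.
rewrite -[_ == 0]negbK -lt0n -has_count => /negP; apply.
apply/hasP; exists (row_len lam 0) => //.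
by apply: mem_nth; case: lam c_lt.
Qed.

Definition conj_part (lam : intpart) : intpart := IntPart (is_intpart_cols lam).

Lemma col_len0 (lam : intpart) : col_len lam 0 = size lam.
Proof.
apply/eqP; rewrite -all_count; apply/allP => x x_lam; rewrite lt0n.
by apply: contraTneq x_lam => ->; case/andP: (partsP lam).
Qed.

Lemma cols_conj_part (lam : intpart) : cols (conj_part lam) = lam.
Proof.
case/andP: (partsP lam) => ss s0.
have geq_tr : transitive geq by move=> y x z xy zx; apply: leq_trans zx xy.
have nth_dec i j : i <= j -> nth 0 lam j <= nth 0 lam i.
  move=> ij; have [jl|lj] := ltnP j (size lam); last by rewrite (nth_default _ lj).
  have := sorted_leq_nth geq_tr leqnn 0 ss; apply=> //.
  by rewrite inE (leq_ltn_trans ij).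
have colE c r : (r < col_len lam c) = (c < nth 0 lam r).
  rewrite /col_len; elim: (parts lam) ss r {s0 nth_dec} => [|x s IHs] ss r /=.
    by rewrite nth_nil.
  have {}IHs := IHs (path_sorted ss).
  have [cx|xc] := ltnP c x; first by case: r => [|r] /=; rewrite ?cx // add1n ltnS.
  have s_le y : y \in s -> y <= c.
    by move=> ys; have /allP/(_ y ys) := order_path_min geq_tr ss => /leq_trans->.
  have -> : count (fun y => c < y) s = 0.
    apply/eqP; rewrite -[_ == 0]negbK -lt0n -has_count; apply/hasPn => y /s_le.
    by rewrite -leqNgt.
  rewrite ltn0; apply/esym/negbTE; rewrite -leqNgt.
  case: r => [|r] //=; have [rs|sr] := ltnP r (size s); last by rewrite nth_default.
  exact/s_le/mem_nth.
have row0 : row_len (conj_part lam) 0 = size lam.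
  rewrite /row_len /= /cols; have [j0|n0] := posnP (row_len lam 0).
    rewrite j0 /=; have [->//|k0] := posnP (size lam).
    by have := mem_nth 0 k0; rewrite -/(row_len _ _) j0 (negPf s0).
  by rewrite nth_mkseq // col_len0.
apply: (@eq_from_nth _ 0); first by rewrite size_mkseq row0.
move=> r; rewrite size_mkseq row0 => r_lt; rewrite nth_mkseq ?row0 //.
rewrite /col_len /= /cols /mkseq count_map (eq_count (a2 := fun c => c < nth 0 lam r)).
  rewrite -(@eq_count _ (mem (iota 0 (nth 0 lam r)))); last first.
    by move=> c; rewrite /= mem_iota.
  rewrite -size_filter -[RHS](size_iota 0); apply/perm_size/uniq_perm.
  - by rewrite filter_uniq ?iota_uniq.
  - exact: iota_uniq.
  move=> c; rewrite mem_filter andb_idr //= !mem_iota !add0n /= => c_lt.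
  exact: leq_trans c_lt (nth_dec 0 r (leq0n r)).
by move=> c; rewrite /= colE.
Qed.

(* Zero entries are not yet discarded in the two sequences below. *)
Definition rho1_cols (lam : seq nat) : seq nat :=
  (row_len lam 0 + 1) :: [seq h - 1 | h <- cols lam].
Definition psi2_rows (lam : seq nat) : seq nat :=
  (col_len lam 0 + 2) :: [seq l - 1 | l <- lam].

Lemma is_intpart_rho1 (lam : intpart) : col_len lam 0 <= row_len lam 0 + 2 ->
  is_intpart [seq h <- rho1_cols lam | h != 0].
Proof.
move=> kj; apply: is_intpart_nz; have /andP[cs _] := is_intpart_cols lam.
have := sorted_geq_subn1 cs; rewrite /rho1_cols /cols /mkseq.
case: (row_len lam 0) kj => [|j] //= kj ->.
by rewrite andbT /geq /= leq_subLR (addnC 1) -addnA.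
Qed.

Lemma is_intpart_psi2 (lam : intpart) : row_len lam 0 <= col_len lam 0 + 3 ->
  is_intpart [seq l <- psi2_rows lam | l != 0].
Proof.
move=> jk; apply: is_intpart_nz; have /andP[ss _] := partsP lam.
have := sorted_geq_subn1 ss; rewrite /psi2_rows; move: (col_len lam 0) jk => k.
rewrite /row_len; case: (parts lam) => [|x s] //= jk ->.
by rewrite andbT /geq /= leq_subLR addnCA.
Qed.

(* The condition k - 2 <= j is written k <= j + 2 since subtraction in nat is
   truncated.  The column heights prescribed for rho_1 are turned into row
   lengths by conjugation, see rho1_colsE. *)
Definition rho1 (lam : intpart) : option intpart :=
  match decP (@idP (col_len lam 0 <= row_len lam 0 + 2)) with
  | left h => Some (conj_part (IntPart (is_intpart_rho1 h)))
  | right _ => None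
  end.

Definition psi2 (lam : intpart) : option intpart :=
  match decP (@idP (row_len lam 0 <= col_len lam 0 + 3)) with
  | left h => Some (IntPart (is_intpart_psi2 h))
  | right _ => None
  end.

Lemma rho1_defined lam : rho1 lam = (col_len lam 0 <= row_len lam 0 + 2) :> bool.
Proof. by rewrite /rho1; case: decP => h; apply/esym; [exact: h | exact/negbTE/negP]. Qed.

Lemma psi2_defined lam : psi2 lam = (row_len lam 0 <= col_len lam 0 + 3) :> bool.
Proof. by rewrite /psi2; case: decP => h; apply/esym; [exact: h | exact/negbTE/negP]. Qed.

Lemma rho1_colsE lam mu : rho1 lam = Some mu ->
  cols mu = [seq h <- rho1_cols lam | h != 0].
Proof. by rewrite /rho1; case: decP => // h [<-]; rewrite cols_conj_part. Qed.

(* Main.v *)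
(* Moving the first row of a diagram to a first column (or conversely) changes
   neither the arm nor the leg of any box outside the moved strip, so only that
   strip matters.  Its contribution is read off the boundary path, along which
   the sum x + y of the coordinates goes up by 1 at each horizontal step and
   down by 1 at each vertical step: the boxes counted are the steps crossing a
   fixed edge of Z/3, and the number of up-crossings minus the number of
   down-crossings depends only on the endpoints of the path. *)
Require Import Defs.
From mathcomp Require Import all_boot zify.

Set Implicit Arguments.
Unset Strict Implicit.
Unset Printing Implicit Defensive.

(** * Counting boxes row by row *)

(* Arms and legs only involve the rows from the given box up, whence the
   recursion on the list of rows. *)
Fixpoint box_count (P : rel nat) (s : seq nat) : nat :=
  if s is x :: s' then
    \sum_(c < x) P (col_len s' c) (x - c.+1) + box_count P s'
  else 0.

Lemma boxes_cons x s :
  boxes (x :: s) =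
  [seq (0, c) | c <- iota 0 x] ++ [seq (b.1.+1, b.2) | b <- boxes s].
Proof.
rewrite /boxes /= map_flatten -map_comp; congr (_ ++ flatten _).
rewrite (iotaDl 1 0) -map_comp; apply: eq_map => r /=.
by rewrite -map_comp.
Qed.

Lemma count_boxes_col s c : count (fun b => b.2 == c) (boxes s) = col_len s c.
Proof.
elim: s => // x s IHs; rewrite boxes_cons count_cat !count_map /=.
rewrite [X in _ + X](_ : _ = col_len s c); last by rewrite -IHs; apply: eq_count.
congr (_ + _); rewrite -[RHS]/(nat_of_bool (0 <= c < 0 + x)) -mem_iota.
by rewrite -count_uniq_mem ?iota_uniq //; apply: eq_count.
Qed.

Lemma count_gt_iota c x : count (fun i => c < i) (iota 0 x) = x - c.+1.
Proof.
elim: x => // x IHx; rewrite -[in iota _ _]addn1 iotaD count_cat IHx /=.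
by case: ltnP; lia.
Qed.

Lemma count_lt_iota m x : count (fun i => i < m) (iota 0 x) = minn m x.
Proof.
elim: x => [|x IHx]; first by rewrite minn0.
rewrite -[in iota _ _]addn1 iotaD count_cat IHx /=.
by case: ltnP; lia.
Qed.

Lemma count_boxes P s :
  count (fun b => P (arm s b) (leg s b)) (boxes s) = box_count P s.
Proof.
elim: s => // x s IHs; rewrite boxes_cons count_cat !count_map /= -IHs.
congr (_ + _).
  rewrite -(big_mkord xpredT (fun c => P (col_len s c) (x - c.+1) : nat)).
  rewrite -sum1_count big_mkcond /index_iota subn0; apply: eq_bigr => c _ /=.
  have -> : arm (x :: s) (0, c) = col_len s c.
    rewrite /arm boxes_cons count_cat !count_map /= -count_boxes_col.
    rewrite (@eq_count _ _ pred0) => [|i] /=; last by rewrite andbF.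
    by rewrite count_pred0; apply: eq_count => b /=; rewrite andbT.
  have -> : leg (x :: s) (0, c) = x - c.+1.
    rewrite /leg boxes_cons count_cat !count_map /= -count_gt_iota.
    rewrite [X in _ + X](@eq_count _ _ pred0) // count_pred0 addn0.
    exact: eq_count.
  by case: (P _ _).
apply: eq_count => -[r c] /=; congr (P _ _).
  rewrite /arm boxes_cons count_cat !count_map /=.
  rewrite (@eq_count _ _ pred0) => [|i] /=; last by rewrite andbF.
  by rewrite count_pred0; apply: eq_count.
rewrite /leg boxes_cons count_cat !count_map /=.
rewrite (@eq_count _ _ pred0) // count_pred0.
exact: eq_count.
Qed.

Lemma col_len_pred s c : col_len [seq x - 1 | x <- s] c = col_len s c.+1.
Proof. by rewrite /col_len count_map; apply: eq_count => x /=; lia. Qed.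

Lemma col_len_nz s c : col_len [seq x <- s | x != 0] c = col_len s c.
Proof. by rewrite /col_len count_filter; apply: eq_count => x /=; lia. Qed.

Lemma box_count_nz P s : box_count P [seq x <- s | x != 0] = box_count P s.
Proof.
elim: s => // -[|x] s IHs /=; first by rewrite big_ord0.
by rewrite IHs; under eq_bigr do rewrite col_len_nz.
Qed.

(** * Rows against columns, and conjugation *)

Lemma sorted_geq_cons x s : sorted geq (x :: s) ->
  {in s, forall y, y <= x} /\ sorted geq s.
Proof.
move=> /= xs; split; last exact: path_sorted xs.
have geq_tr : transitive geq by move=> b a c ab bc; apply: leq_trans bc ab.
by have /allP := order_path_min geq_tr xs.
Qed.

Lemma col_len_eq0 s c : {in s, forall y, y <= c} -> col_len s c = 0.
Proof.
move=> s_le; rewrite /col_len (@eq_in_count _ _ pred0) ?count_pred0 // => y.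
by move=> /s_le; rewrite ltnNge => ->.
Qed.

(** Both sides say that the box in row [r] and column [c] lies in the diagram. *)
Lemma ltn_col_len s c r : sorted geq s ->
  (r < col_len s c) = (c < nth 0 s r).
Proof.
elim: s r => [|x s IHs] r; first by rewrite nth_nil.
move=> /sorted_geq_cons[s_le /IHs{}IHs].
have [cx|xc] := ltnP c x.
  by case: r => [|r]; rewrite /col_len /= cx // add1n ltnS IHs.
rewrite [LHS](_ : _ = false); last first.
  rewrite col_len_eq0 // => y; rewrite inE => /predU1P[->//|/s_le yx].
  exact: leq_trans yx xc.
case: r => [|r] /=; first by rewrite ltnNge xc.
have [rs|sr] := ltnP r (size s); last by rewrite nth_default.
by rewrite ltnNge (leq_trans _ xc) // s_le // mem_nth.
Qed.

Lemma col_len_mkseq s n r : sorted geq s -> {in s, forall y, y <= n} ->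
  col_len (mkseq (col_len s) n) r = nth 0 s r.
Proof.
move=> ss s_le; rewrite /col_len count_map -/(col_len s).
rewrite (@eq_count _ _ (fun c => c < nth 0 s r)) => [|c] /=; last first.
  exact: ltn_col_len.
rewrite count_lt_iota; apply/minn_idPl.
have [rs|sr] := ltnP r (size s); last by rewrite nth_default.
by rewrite s_le ?mem_nth.
Qed.

(** Deleting the first column changes neither the arm nor the leg of the other boxes. Zero rows are
    allowed, so the column has height [col_len s 0] rather than [size s]. *)
Lemma box_count_first_col P s : sorted geq s ->
  box_count P s =
  \sum_(r < col_len s 0) P (col_len s 0 - r.+1) (nth 0 s r - 1) +
  box_count P [seq x - 1 | x <- s].
Proof.
elim: s => [|x s IHs]; first by rewrite big_ord0.
move=> /sorted_geq_cons[s_le /IHs{}IHs]; rewrite [LHS]/= IHs.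
case: x => [|x] in s_le *.
  have -> : col_len (0 :: s) 0 = 0 by rewrite -[LHS]/(col_len s 0) col_len_eq0.
  by rewrite (col_len_eq0 s_le) /= !big_ord0.
have -> : col_len (x.+1 :: s) 0 = (col_len s 0).+1 by [].
rewrite [in RHS]/= !subn1 !big_ord_recl /= !subSS !subn0 -!addnA.
congr (_ + _); rewrite addnCA; congr (_ + (_ + _)).
by apply: eq_bigr => c _; rewrite col_len_pred subSS.
Qed.

(** Conjugation exchanges arms and legs. The induction peels the first row off the conjugate and the
    first column off [s]. *)
Lemma box_count_mkseq P s n : sorted geq s -> {in s, forall y, y <= n} ->
  box_count P (mkseq (col_len s) n) = box_count (fun a l => P l a) s.
Proof.
elim: n s => [|n IHn] s ss s_le.
  rewrite -[RHS]box_count_nz; have -> // : [seq x <- s | x != 0] = [::].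
  apply/eqP; rewrite -(negbK (_ == _)) -has_filter; apply/hasPn => x /s_le.
  by rewrite leqn0 negbK.
have s_le' : {in [seq x - 1 | x <- s], forall y, y <= n}.
  by move=> _ /mapP[x /s_le xn ->]; lia.
have ss' := sorted_geq_subn1 ss.
rewrite [RHS]box_count_first_col // -IHn //.
have -> : mkseq (col_len s) n.+1 =
    col_len s 0 :: mkseq (col_len [seq x - 1 | x <- s]) n.
  rewrite /mkseq /= (iotaDl 1 0) -map_comp; congr (_ :: _).
  by apply: eq_map => c; rewrite /= col_len_pred.
congr (_ + _); apply: eq_bigr => r _; rewrite col_len_mkseq //.
congr (nat_of_bool (P _ _)).
have [rs|sr] := ltnP r (size s); first by rewrite (nth_map 0).
by rewrite !nth_default ?size_map.
Qed.

Lemma row_len_max s : sorted geq s -> {in s, forall y, y <= row_len s 0}.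
Proof.
case: s => // x s /sorted_geq_cons[s_le _] y.
by rewrite inE => /predU1P[->//|/s_le].
Qed.

Lemma box_count_cols P s : sorted geq s ->
  box_count P (cols s) = box_count (fun a l => P l a) s.
Proof. by move=> ss; apply: box_count_mkseq => //; apply: row_len_max. Qed.

(** Each count is that of [s] without its first column plus one strip; adding the other strip on
    each side avoids subtraction. *)
Lemma box_count_move_col P s m : sorted geq s ->
  box_count P [seq x <- m :: [seq x - 1 | x <- s] | x != 0] +
    \sum_(r < col_len s 0) P (col_len s 0 - r.+1) (nth 0 s r - 1) =
  box_count P s + \sum_(c < m) P (col_len s c.+1) (m - c.+1).
Proof.
move=> ss; rewrite box_count_nz /= [in RHS]box_count_first_col //.
by under eq_bigr do rewrite col_len_pred; rewrite -addnA addnC [X in X + _ = _]addnC.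
Qed.

(** * Crossings along the boundary path *)

(* [f i] is the weight of the edge between [i] and [i + 1]: both sides compare
   the ups and the downs of x + y along the boundary path from (0, size s) to
   (N, 0). *)
Lemma boundary_path (f : nat -> nat) s N :
  sorted geq s -> {in s, forall y, y <= N} ->
  \sum_(c < N) f (c + col_len s c) + \sum_(i < size s) f i =
  \sum_(r < size s) f (nth 0 s r + r) + \sum_(i < N) f i.
Proof.
elim: s f N => [|x s IHs] f N.
  by move=> _ _; rewrite !big_ord0 addn0; apply: eq_bigr => c _; rewrite addn0.
move=> /sorted_geq_cons[s_le ss] xs_le.
have xN : x <= N by apply: xs_le; rewrite mem_head.
(* The bottom row raises the path of [s] by one, hence [f \o S]; this path need only reach column
   [x], where the bottom row ends. *)
have := IHs (f \o S) x ss s_le; rewrite /= !big_ord_recl /= addn0.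
rewrite -(big_mkord xpredT (fun c => f (c + col_len (x :: s) c))).
rewrite -(big_mkord xpredT f) !(@big_cat_nat _ _ _ x 0 N) //= !big_mkord.
have -> : \sum_(c < x) f (c + col_len (x :: s) c) =
          \sum_(c < x) f (c + col_len s c).+1.
  by apply: eq_bigr => c _; rewrite {1}/col_len /= ltn_ord add1n addnS.
have -> : \sum_(x <= c < N) f (c + col_len (x :: s) c) = \sum_(x <= c < N) f c.
  apply: eq_big_nat => c /andP[xc _]; rewrite col_len_eq0 ?addn0 // => y.
  by rewrite inE => /predU1P[->//|/s_le yx]; apply: leq_trans yx xc.
have -> : \sum_(r < size s) f (nth 0 s r + bump 0 r) =
          \sum_(r < size s) f (nth 0 s r + r).+1.
  by apply: eq_bigr => r _; rewrite /bump /= add1n addnS.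
have -> : \sum_(i < size s) f (bump 0 i) = \sum_(i < size s) f i.+1.
  by apply: eq_bigr.
(* Undoing the shift of the weights costs [f 0] against [f x], the vertical step at the end of the
   bottom row. *)
have : \sum_(i < x) f i + f x = f 0 + \sum_(i < x) f i.+1.
  transitivity (\sum_(i < x.+1) f i); first by rewrite big_ord_recr.
  by rewrite big_ord_recl.
rewrite /=; lia.
Qed.

(** The horizontal step of the moved column is left out; its weight is [f (size s)]. *)
Lemma boundary_path_from1 (f : nat -> nat) (s : intpart) m :
  row_len s 0 <= m.+1 -> f (size s) = 0 ->
  \sum_(c < m) f (c.+1 + col_len s c.+1) + \sum_(i < size s) f i =
  \sum_(r < size s) f (nth 0 s r + r) + \sum_(i < m.+1) f i.
Proof.
move=> s0m f0; have /andP[ss _] := partsP s.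
rewrite -(boundary_path f ss) => [|y /(row_len_max ss) ys]; last first.
  exact: leq_trans ys s0m.
by rewrite big_ord_recl /= add0n col_len0 f0.
Qed.

Lemma nth_part_gt0 (s : intpart) (r : 'I_(size s)) : 0 < nth 0 s r.
Proof.
have /andP[_ s0] := partsP s.
by rewrite lt0n; apply: contraNneq s0 => <-; apply: mem_nth.
Qed.

Theorem theorem3p7 (lam : intpart) :
  (forall mu : intpart, rho1 lam = Some mu -> wt3 mu = wt3 lam) /\
  (forall mu : intpart, psi2 lam = Some mu -> wt3 mu = wt3 lam + 1).
Proof.
pose P a l := a + 1 == l %[mod 3].
have wt3E s : wt3 s = box_count P s by rewrite -count_boxes.
split=> mu.
  rewrite /rho1; case: decP => // h [<-]; rewrite !wt3E.
  (* After conjugation a first column becomes a first row, as for [psi2], with arms and legs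
     exchanged. *)
  rewrite -[in RHS](cols_conj_part lam).
  set s := conj_part lam; have /andP[ss _] := partsP s.
  have sz : size s = row_len lam 0 by rewrite /= size_mkseq.
  have s0 : row_len s 0 = size lam.
    by rewrite -[in RHS](cols_conj_part lam) size_mkseq.
  rewrite (box_count_cols _ ss) box_count_cols; last first.
    by have /andP[] := is_intpart_rho1 h.
  have := box_count_move_col (fun a l => P l a) (row_len lam 0 + 1) ss.
  rewrite col_len0 -/(rho1_cols lam).
  (* The residue is [size s - 1], written without subtraction. The one added box makes both strips
     use the same edge. *)
  pose f i : nat := i == size s + 2 %[mod 3].
  have <- : \sum_(r < size s) f (nth 0 s r + r) =
      \sum_(r < size s) P (nth 0 s r - 1) (size s - r.+1).
    apply: eq_bigr => r _; have := ltn_ord r; have := nth_part_gt0 r.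
    by rewrite /f /P; lia.
  have <- : \sum_(c < row_len lam 0 + 1) f (c.+1 + col_len s c.+1) =
      \sum_(c < row_len lam 0 + 1) P (row_len lam 0 + 1 - c.+1) (col_len s c.+1).
    by apply: eq_bigr => c _; have := ltn_ord c; rewrite /f /P; lia.
  have := @boundary_path_from1 f s (row_len lam 0 + 1).
  rewrite s0 -(col_len0 lam) -sz addn1 !big_ord_recr /=.
  (* The endpoints differ by the two edges from [size s] on, neither of them counted: the weight is
     preserved. *)
  rewrite [f (size s)](_ : _ = 0); last by rewrite /f; lia.
  rewrite [f (size s).+1](_ : _ = 0); last by rewrite /f; lia.
  move=> /(_ _ erefl); move: h; rewrite -sz /=; lia.
rewrite /psi2; case: decP => // h [<-]; rewrite !wt3E.
have /andP[ss _] := partsP lam.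
rewrite -[parts (IntPart _)]/[seq x <- psi2_rows lam | x != 0] /psi2_rows.
have := box_count_move_col P (col_len lam 0 + 2) ss.
move: h; rewrite col_len0 => h.
pose f i : nat := i == size lam + 1 %[mod 3].
have <- : \sum_(r < size lam) f (nth 0 lam r + r) =
    \sum_(r < size lam) P (size lam - r.+1) (nth 0 lam r - 1).
  apply: eq_bigr => r _; have := ltn_ord r; have := nth_part_gt0 r.
  by rewrite /f /P; lia.
have <- : \sum_(c < size lam + 2) f (c.+1 + col_len lam c.+1) =
    \sum_(c < size lam + 2) P (col_len lam c.+1) (size lam + 2 - c.+1).
  by apply: eq_bigr => c _; have := ltn_ord c; rewrite /f /P; lia.
(* The condition for [psi2] to be defined says that the path fits in these columns. *)
have hm : row_len lam 0 <= (size lam + 2).+1 by rewrite -addnS.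
have := @boundary_path_from1 f _ _ hm; rewrite addn2 !big_ord_recr /=.
(* Three consecutive edges now remain, a full period mod 3; the one counted among them is the added
   1. *)
rewrite [f (size lam)](_ : _ = 0); last by rewrite /f; lia.
rewrite [f (size lam).+1](_ : _ = 1); last by rewrite /f; lia.
rewrite [f (size lam).+2](_ : _ = 0); last by rewrite /f; lia.
move=> /(_ erefl) /=; lia.
Qed.
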